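(* Let $\tau:HH\to HH$ be a local prebraiding with $\tau^2=1$ and let $\mathbf{H}=(H,m,e,\delta,\varepsilon)$ be a $\tau$-bimonad on a category $\mathbb{A}$. Then: (1) $\mathbf{H}'=(H,m\cdot\tau,e,\tau\cdot\delta,\varepsilon)$ is also a $\tau$-bimonad. (2) If $\mathbf{H}$ has an antipode $S$ with $\tau\cdot HS=SH\cdot\tau$ and $\tau\cdot SH=HS\cdot\tau$, then $S$ is a $\tau$-bimonad morphism between the $\tau$-bimonads $\mathbf{H}$ and $\mathbf{H}'$. In this case $S$ is an antipode for $\mathbf{H}'$.
   Context: Composition of functors is written by juxtaposition, $\cdot$ is vertical composition, $H\alpha,\alpha H$ are whiskerings, and $\alpha\beta$ is the horizontal composite. Let $(H,m,e)$ be a monad and $(H,\delta,\varepsilon)$ a comonad on $\mathbb{A}$ with the same underlying endofunctor $H$. A double entwining (for these structures) is a natural transformation $\tau:HH\to HH$ satisfying $\tau\cdot eH=He$, $\varepsilon H\cdot\tau=H\varepsilon$, $\delta H\cdot\tau=H\tau\cdot\tau H\cdot H\delta$, $\tau\cdot mH=Hm\cdot\tau H\cdot H\tau$, $\tau\cdot He=eH$, $H\varepsilon\cdot\tau=\varepsilon H$, $H\delta\cdot\tau=\tau H\cdot H\tau\cdot\delta H$, $\tau\cdot Hm=mH\cdot H\tau\cdot\tau H$. It is a local prebraiding if moreover it satisfies the Yang–Baxter equation $\tau H\cdot H\tau\cdot\tau H=H\tau\cdot\tau H\cdot H\tau$. $(H,m,e,\delta,\varepsilon)$ is a $\tau$-bimonad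 if $\tau$ is a double entwining for it and $\delta\cdot m=mm\cdot H\tau H\cdot\delta\delta$, $\varepsilon\cdot m=\varepsilon\cdot H\varepsilon$, $\delta\cdot e=eH\cdot e$, $\varepsilon\cdot e=1$. An antipode is a natural transformation $S:H\to H$ with $m\cdot SH\cdot\delta=e\cdot\varepsilon=m\cdot HS\cdot\delta$. A $\tau$-bimonad morphism $\mathbf{H}\to\mathbf{H}'$ is a natural transformation that is both a morphism of the underlying monads and a morphism of the underlying comonads. *)

(* Defs.v *)
Set Implicit Arguments.
Unset Strict Implicit.
Unset Printing Implicit Defensive.

Declare Scope cat_scope.
Delimit Scope cat_scope with cat.
Local Open Scope cat_scope.

Record category : Type := Category {
  obj :> Type;
  hom : obj -> obj -> Type;
  idc : forall X, hom X X;
  comp : forall X Y Z, hom Y Z -> hom X Y -> hom X Z;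
  comp_idl : forall X Y (f : hom X Y), comp (idc Y) f = f;
  comp_idr : forall X Y (f : hom X Y), comp f (idc X) = f;
  comp_assoc : forall W X Y Z (h : hom Y Z) (g : hom X Y) (f : hom W X),
    comp h (comp g f) = comp (comp h g) f
}.

Record functor (A B : category) : Type := Functor {
  fobj :> A -> B;
  fmap : forall X Y : A, hom X Y -> hom (fobj X) (fobj Y);
  fmap_id : forall X : A, fmap (idc X) = idc (fobj X);
  fmap_comp : forall (X Y Z : A) (g : hom Y Z) (f : hom X Y),
    fmap (comp g f) = comp (fmap g) (fmap f)
}.

Definition functor_id (A : category) : functor A A :=
  @Functor A A (fun X => X) (fun X Y f => f)
    (fun X => eq_refl) (fun X Y Z g f => eq_refl).

Definition functor_comp (A B C : category) (F : functor B C) (G : functor A B) :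
  functor A C.
Proof.
refine (@Functor A C (fun X => F (G X)) (fun X Y f => fmap F (fmap G f)) _ _).
- intros X. rewrite fmap_id. apply fmap_id.
- intros X Y Z g f. rewrite fmap_comp. apply fmap_comp.
Defined.

Notation "F ∘ G" := (functor_comp F G) (at level 30, right associativity)
  : cat_scope.

(* The body mentions only the object and morphism parts of F and G, never their
   law proofs. Hence the types of transformations between (F ∘ G) ∘ K and
   F ∘ (G ∘ K), or between functor_id ∘ F and F, are convertible to one another,
   and no associator or unitor has to be inserted in the equations below. *)
Definition nat_trans (A B : category) (F G : functor A B) : Type :=
  { a : forall X : A, hom (F X) (G X) |
    forall (X Y : A) (f : hom X Y),
      comp (a Y) (fmap F f) = comp (fmap G f) (a X) }.

Notation "F ⟹ G" := (nat_trans F G) (at level 70, no associativity)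
  : cat_scope.

Definition component (A B : category) (F G : functor A B) (a : F ⟹ G) (X : A) :
  hom (F X) (G X) := proj1_sig a X.

(* Equality of natural transformations is equality of all components; this
   avoids appealing to functional extensionality and proof irrelevance. *)
Definition nat_eq (A B : category) (F G : functor A B) (a b : F ⟹ G) : Prop :=
  forall X : A, component a X = component b X.

Notation "a ≡ b" := (nat_eq a b) (at level 70, no associativity) : cat_scope.

Definition nat_id (A B : category) (F : functor A B) : F ⟹ F.
Proof.
exists (fun X => idc (F X)).
intros X Y f. rewrite comp_idl, comp_idr. reflexivity.
Defined.

Definition vcomp (A B : category) (F G K : functor A B)
  (b : G ⟹ K) (a : F ⟹ G) : F ⟹ K.
Proof.
exists (fun X => comp (component b X) (component a X)).
intros X Y f. unfold component. destruct a as [a Ha], b as [b Hb]; simpl.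
rewrite <- comp_assoc, Ha, comp_assoc, Hb, comp_assoc. reflexivity.
Defined.

Notation "b · a" := (vcomp b a) (at level 40, left associativity) : cat_scope.

Definition whisker_left (A B C : category) (K : functor B C)
  (F G : functor A B) (a : F ⟹ G) : K ∘ F ⟹ K ∘ G.
Proof.
exists (fun X => fmap K (component a X)).
intros X Y f. unfold component. destruct a as [a Ha]; simpl.
rewrite <- !fmap_comp, Ha. reflexivity.
Defined.

Notation "K ◁ a" := (whisker_left K a) (at level 35, right associativity)
  : cat_scope.

Definition whisker_right (A B C : category) (F G : functor B C)
  (a : F ⟹ G) (K : functor A B) : F ∘ K ⟹ G ∘ K.
Proof.
exists (fun X => component a (K X)).
intros X Y f. unfold component. destruct a as [a Ha]; simpl. apply Ha.
Defined.

Notation "a ▷ K" := (whisker_right a K) (at level 34, left associativity)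
  : cat_scope.

Definition hcomp (A B C : category) (F F' : functor B C) (G G' : functor A B)
  (a : F ⟹ F') (b : G ⟹ G') : F ∘ G ⟹ F' ∘ G' :=
  (a ▷ G') · (F ◁ b).

Notation "a ★ b" := (hcomp a b) (at level 35, no associativity) : cat_scope.

Section Structures.
Variables (A : category) (H : functor A A).
Implicit Types (m : H ∘ H ⟹ H) (e : functor_id A ⟹ H).
Implicit Types (δ : H ⟹ H ∘ H) (ε : H ⟹ functor_id A).
Implicit Types (τ : H ∘ H ⟹ H ∘ H) (S : H ⟹ H).

Record is_monad m e : Prop := IsMonad {
  monad_assoc : m · (m ▷ H) ≡ m · (H ◁ m);
  monad_unitl : m · (e ▷ H) ≡ nat_id H;
  monad_unitr : m · (H ◁ e) ≡ nat_id H
}.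

Record is_comonad δ ε : Prop := IsComonad {
  comonad_coassoc : (δ ▷ H) · δ ≡ (H ◁ δ) · δ;
  comonad_counitl : (ε ▷ H) · δ ≡ nat_id H;
  comonad_counitr : (H ◁ ε) · δ ≡ nat_id H
}.

Record double_entwining m e δ ε τ : Prop := DoubleEntwining {
  dent_unitl : τ · (e ▷ H) ≡ H ◁ e;
  dent_counitl : (ε ▷ H) · τ ≡ H ◁ ε;
  dent_comull : (δ ▷ H) · τ ≡ (H ◁ τ) · (τ ▷ H) · (H ◁ δ);
  dent_mull : τ · (m ▷ H) ≡ (H ◁ m) · (τ ▷ H) · (H ◁ τ);
  dent_unitr : τ · (H ◁ e) ≡ e ▷ H;
  dent_counitr : (H ◁ ε) · τ ≡ ε ▷ H;
  dent_comulr : (H ◁ δ) · τ ≡ (τ ▷ H) · (H ◁ τ) · (δ ▷ H);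
  dent_mulr : τ · (H ◁ m) ≡ (m ▷ H) · (H ◁ τ) · (τ ▷ H)
}.

Definition yang_baxter τ : Prop :=
  (τ ▷ H) · (H ◁ τ) · (τ ▷ H) ≡ (H ◁ τ) · (τ ▷ H) · (H ◁ τ).

Definition local_prebraiding m e δ ε τ : Prop :=
  double_entwining m e δ ε τ /\ yang_baxter τ.

Record tau_bimonad τ m e δ ε : Prop := TauBimonad {
  bimonad_monad : is_monad m e;
  bimonad_comonad : is_comonad δ ε;
  bimonad_entwining : double_entwining m e δ ε τ;
  bimonad_comul_mul : δ · m ≡ (m ★ m) · (H ◁ (τ ▷ H)) · (δ ★ δ);
  bimonad_counit_mul : ε · m ≡ ε · (H ◁ ε);
  bimonad_comul_unit : δ · e ≡ (e ▷ H) · e;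
  bimonad_counit_unit : ε · e ≡ nat_id (functor_id A)
}.

Record antipode m e δ ε S : Prop := Antipode {
  antipode_left : m · (S ▷ H) · δ ≡ e · ε;
  antipode_right : m · (H ◁ S) · δ ≡ e · ε
}.

End Structures.

Section Morphisms.
Variables (A : category) (H H' : functor A A).

Record monad_morphism
    (m : H ∘ H ⟹ H) (e : functor_id A ⟹ H)
    (m' : H' ∘ H' ⟹ H') (e' : functor_id A ⟹ H') (f : H ⟹ H') : Prop :=
  MonadMorphism {
    monad_morphism_mul : f · m ≡ m' · (f ★ f);
    monad_morphism_unit : f · e ≡ e'
  }.

Record comonad_morphism
    (δ : H ⟹ H ∘ H) (ε : H ⟹ functor_id A)
    (δ' : H' ⟹ H' ∘ H') (ε' : H' ⟹ functor_id A) (f : H ⟹ H') : Prop :=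
  ComonadMorphism {
    comonad_morphism_comul : δ' · f ≡ (f ★ f) · δ;
    comonad_morphism_counit : ε' · f ≡ ε
  }.

Definition tau_bimonad_morphism
    (m : H ∘ H ⟹ H) (e : functor_id A ⟹ H)
    (δ : H ⟹ H ∘ H) (ε : H ⟹ functor_id A)
    (m' : H' ∘ H' ⟹ H') (e' : functor_id A ⟹ H')
    (δ' : H' ⟹ H' ∘ H') (ε' : H' ⟹ functor_id A) (f : H ⟹ H') : Prop :=
  monad_morphism m e m' e' f /\ comonad_morphism δ ε δ' ε' f.

End Morphisms.

(* Main.v *)
Require Import Defs.

(** The double entwining axioms say that [τ] lets any of the structure maps
    [m], [e], [δ], [ε] slide through a crossing, on either strand. Together with
    the Yang-Baxter equation and [τ · τ ≡ nat_id _] this makes the endofunctors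
    [H ∘ ... ∘ H] behave as tensor powers of an object in a symmetric monoidal
    category, and the statement becomes two classical facts on a bialgebra [H]
    there: its opposite-coopposite is a bialgebra, and an antipode is a bialgebra
    map from [H] to it.

    For the first fact every axiom reduces, after sliding the structure maps
    through the crossings, to the same axiom for [H]. Where words in the crossings
    are left over, they agree as elements of a symmetric group
    ([opposite_is_monad], [opposite_comul_mul]).

    For the second, [S · m] and [m · τ · (S ★ S)] are a left and a right inverse
    of [m] under convolution of transformations [H ∘ H ⟹ H], hence they are equal
    ([convolution_inverse_unique], [antipode_mul]). The comonad structure on
    [H ∘ H] used by this convolution comes from [τ] as from a distributive law
    ([composite_comonad]). Compatibility of [S] with [δ] is the same fact in the
    opposite category, where monads and comonads are exchanged while [τ] remains
    a double entwining; involutivity of [τ] then moves the crossing to the other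
    side of the equation.

    Equations are proved componentwise: a diagram of transformations becomes a
    composite of morphisms [fmap K (a X)], where [K] stands for the strands to the
    left of [a] and the object [X] absorbs those to its right. *)

Set Implicit Arguments.
Unset Strict Implicit.
Unset Printing Implicit Defensive.

Local Open Scope cat_scope.

#[local] Arguments component {A B F G} !a X /.
Local Coercion component : nat_trans >-> Funclass.
Local Notation "g ⊙ f" := (comp g f) (at level 39, right associativity).

(** * Rewriting in diagrams of natural transformations *)

(** The extra morphism [k] makes every composite right-nested with a tail, so that
    an equation can be applied anywhere in a diagram in a single form. *)
Lemma nat_ext (A B : category) (F G : functor A B) (a b : F ⟹ G) :
  (forall X W (k : hom W (F X)), a X ⊙ k = b X ⊙ k) -> a ≡ b.
Proof.
intros E X. rewrite <- (comp_idr (a X)), <- (comp_idr (b X)). apply E.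
Qed.

Lemma nat_sym (A B : category) (F G : functor A B) (a b : F ⟹ G) :
  a ≡ b -> b ≡ a.
Proof. intros E X. symmetry. apply E. Qed.

Lemma nat_trans_eq (A B : category) (F G : functor A B) (b a c : F ⟹ G) :
  a ≡ b -> b ≡ c -> a ≡ c.
Proof. intros E E' X. rewrite (E X). apply E'. Qed.

Lemma whisker_post (A B C : category) (K : functor B C) (F G : functor A B)
    (a b : F ⟹ G) :
  a ≡ b -> forall X W (k : hom W (K (F X))),
  fmap K (a X) ⊙ k = fmap K (b X) ⊙ k.
Proof. intros E X W k. rewrite (E X). reflexivity. Qed.

Lemma naturality_post (A B C : category) (K : functor B C) (F G : functor A B)
    (a : F ⟹ G) X Y (f : hom X Y) W (k : hom W (K (F X))) :
  fmap K (a Y) ⊙ fmap K (fmap F f) ⊙ k = fmap K (fmap G f) ⊙ fmap K (a X) ⊙ k.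
Proof.
rewrite !comp_assoc, <- !fmap_comp. destruct a as [a Ha]; simpl.
rewrite Ha. reflexivity.
Qed.

Ltac compute_components :=
  cbn [component proj1_sig vcomp whisker_left whisker_right hcomp nat_id
       functor_comp functor_id fobj fmap].
Ltac compute_components_in e :=
  cbn [component proj1_sig vcomp whisker_left whisker_right hcomp nat_id
       functor_comp functor_id fobj fmap] in e.

Ltac expand :=
  compute_components;
  rewrite ?fmap_comp, ?fmap_id, ?comp_idl, ?comp_idr, <- ?comp_assoc;
  compute_components.
Ltac expand_in e :=
  compute_components_in e;
  rewrite ?fmap_comp, ?fmap_id, ?comp_idl, ?comp_idr, <- ?comp_assoc in e;
  compute_components_in e.

Ltac componentwise := apply nat_ext; intros ? ? ?; expand.

(* [use E under K] rewrites one subdiagram along the equation of transformations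
   [E], with the strands [K] on its left and any strands on its right. *)
Ltac rewrite_under K E :=
  match type of E with
  | @nat_eq ?A ?B ?F ?G ?a ?b =>
    let e := fresh "e" in
    pose proof (fun (X : obj A) W (k : hom W (fobj K (fobj F X))) =>
      ltac:(let e := fresh "e" in
            pose proof (@whisker_post A B _ K F G a b E X W k) as e;
            expand_in e; exact e)) as e;
    cbv beta in e; rewrite e; clear e; expand
  end.
Ltac rewrite_here E :=
  match type of E with
  | @nat_eq _ ?B _ _ _ _ => rewrite_under (functor_id B) E
  end.
Tactic Notation "use" constr(E) := rewrite_here E.
Tactic Notation "use" constr(E) "under" constr(K) := rewrite_under K E.
Tactic Notation "use" "<-" constr(E) := rewrite_here (nat_sym E).
Tactic Notation "use" "<-" constr(E) "under" constr(K) :=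
  rewrite_under K (nat_sym E).

(* [slide a] moves the transformation [a] before (to the right of) a neighbour
   acting on other strands; [slide <- a] moves it after such a neighbour. *)
Ltac naturality_of K a tac :=
  let e := fresh "e" in
  pose proof (@naturality_post _ _ _ K _ _ a) as e;
  cbn [functor_comp functor_id fobj fmap] in e; tac e; clear e.
Ltac slide_under K a := naturality_of K a ltac:(fun e => rewrite e).
Ltac slide_back_under K a := naturality_of K a ltac:(fun e => rewrite <- e).
Tactic Notation "slide" constr(a) :=
  match type of a with
  | @nat_trans _ ?B _ _ => slide_under (functor_id B) a
  end.
Tactic Notation "slide" constr(a) "under" constr(K) := slide_under K a.
Tactic Notation "slide" "<-" constr(a) :=
  match type of a with
  | @nat_trans _ ?B _ _ => slide_back_under (functor_id B) a
  end.
Tactic Notation "slide" "<-" constr(a) "under" constr(K) := slide_back_under K a.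

(* A normal form for the interchange law: neighbours acting on disjoint strands are
   ordered so that the one further to the left is applied first. *)
Ltac slide_all H := repeat match goal with
  | a : @nat_trans _ _ _ _ |- _ =>
    first [ slide a | slide a under H | slide a under (H ∘ H)
          | slide a under (H ∘ H ∘ H) | slide a under (H ∘ H ∘ H ∘ H) ]
  end.

Lemma hcomp_interchange (A B C : category) (F F' : functor B C)
    (G G' : functor A B) (a : F ⟹ F') (b : G ⟹ G') :
  a ★ b ≡ (F' ◁ b) · (a ▷ G).
Proof. componentwise. slide a. reflexivity. Qed.

(** * Convolution *)

(** The usual argument that a left inverse [f] and a right inverse [h] of [g] in a
    monoid agree, for the convolution product [μ · (f ★ g) · Δ] with unit
    [η · γ]: both equal the triple convolution of [f], [g], [h]. *)
Lemma convolution_inverse_unique (A : category) (C B : functor A A)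
    (Δ : C ⟹ C ∘ C) (γ : C ⟹ functor_id A)
    (μ : B ∘ B ⟹ B) (η : functor_id A ⟹ B) (f g h : C ⟹ B) :
  is_comonad Δ γ -> is_monad μ η ->
  μ · (f ★ g) · Δ ≡ η · γ -> μ · (g ★ h) · Δ ≡ η · γ -> f ≡ h.
Proof.
intros HC HB fg gh.
apply (nat_trans_eq (b := μ · (f ★ (μ · (g ★ h) · Δ)) · Δ)).
- apply nat_sym. componentwise. use gh under C.
  use (comonad_counitr HC). slide f. use (monad_unitr HB). reflexivity.
- componentwise.
  slide f. use <- (monad_assoc HB). use <- (comonad_coassoc HC).
  slide <- Δ. use fg.
  use (monad_unitl HB). slide γ. use (comonad_counitl HC). reflexivity.
Qed.

(** * Duality *)

Definition op_category (A : category) : category :=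
  @Category A (fun X Y => hom Y X) (@idc A) (fun X Y Z g f => comp f g)
    (fun X Y f => comp_idr f) (fun X Y f => comp_idl f)
    (fun W X Y Z h g f => eq_sym (comp_assoc f g h)).

Definition op_functor (A B : category) (F : functor A B) :
    functor (op_category A) (op_category B) :=
  @Functor (op_category A) (op_category B) F (fun X Y f => fmap F f)
    (fun X => fmap_id F X) (fun X Y Z g f => fmap_comp F f g).

Definition op_nat (A B : category) (F G : functor A B) (a : F ⟹ G) :
    op_functor G ⟹ op_functor F :=
  exist (fun b : forall X : op_category A, @hom (op_category B) (G X) (F X) =>
    forall (X Y : op_category A) (f : hom X Y),
      comp (b Y) (fmap (op_functor G) f) = comp (fmap (op_functor F) f) (b X))
    (component a) (fun X Y f => eq_sym (proj2_sig a Y X f)).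

Section Opposite.
Variables (A : category) (H : functor A A).
Variables (m : H ∘ H ⟹ H) (e : functor_id A ⟹ H).
Variables (δ : H ⟹ H ∘ H) (ε : H ⟹ functor_id A) (τ : H ∘ H ⟹ H ∘ H).

Lemma op_double_entwining : double_entwining m e δ ε τ ->
  @double_entwining (op_category A) (op_functor H)
    (op_nat δ) (op_nat ε) (op_nat m) (op_nat e) (op_nat τ).
Proof.
intros Ht. split; intros X; simpl.
- apply (dent_counitl Ht).
- apply (dent_unitl Ht).
- rewrite comp_assoc. apply (dent_mull Ht).
- rewrite comp_assoc. apply (dent_comull Ht).
- apply (dent_counitr Ht).
- apply (dent_unitr Ht).
- rewrite comp_assoc. apply (dent_mulr Ht).
- rewrite comp_assoc. apply (dent_comulr Ht).
Qed.

Lemma op_yang_baxter : yang_baxter τ ->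
  @yang_baxter (op_category A) (op_functor H) (op_nat τ).
Proof. intros yb X. simpl. rewrite !comp_assoc. apply yb. Qed.

Lemma op_comonad : is_comonad δ ε ->
  @is_monad (op_category A) (op_functor H) (op_nat δ) (op_nat ε).
Proof. intros [? ? ?]. split; assumption. Qed.

Lemma op_monad : is_monad m e ->
  @is_comonad (op_category A) (op_functor H) (op_nat m) (op_nat e).
Proof. intros [? ? ?]. split; assumption. Qed.

(** Passing to the opposite category reverses the order of the two factors in a
    horizontal composite, hence the appeals to interchange and naturality. *)
Lemma op_tau_bimonad : tau_bimonad τ m e δ ε ->
  @tau_bimonad (op_category A) (op_functor H) (op_nat τ)
    (op_nat δ) (op_nat ε) (op_nat m) (op_nat e).
Proof.
intros [Hm Hd Ht comul_mul counit_mul comul_unit counit_unit]. split.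
- apply op_comonad; assumption.
- apply op_monad; assumption.
- apply op_double_entwining; assumption.
- intros X. pose proof (hcomp_interchange δ δ X) as dd.
  pose proof (hcomp_interchange m m X) as mm. simpl in dd, mm.
  etransitivity; [apply comul_mul|]. simpl.
  rewrite dd, mm, <- !comp_assoc. reflexivity.
- intros X. etransitivity; [apply comul_unit|]. exact (proj2_sig e _ _ _).
- intros X. etransitivity; [apply counit_mul|]. exact (proj2_sig ε _ _ _).
- assumption.
Qed.

Lemma op_antipode (S : H ⟹ H) : antipode m e δ ε S ->
  @antipode (op_category A) (op_functor H)
    (op_nat δ) (op_nat ε) (op_nat m) (op_nat e) (op_nat S).
Proof.
intros [Sl Sr]. split; intros X; simpl; rewrite comp_assoc; [apply Sl|apply Sr].
Qed.
End Opposite.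

(** * Composites and opposites along a double entwining *)

(** A double entwining is in particular a distributive law of the comonad [H] over
    itself, and this is the composite comonad of that law. *)
Lemma composite_comonad (A : category) (H : functor A A)
    (m : H ∘ H ⟹ H) (e : functor_id A ⟹ H)
    (δ : H ⟹ H ∘ H) (ε : H ⟹ functor_id A) (τ : H ∘ H ⟹ H ∘ H) :
  is_comonad δ ε -> double_entwining m e δ ε τ ->
  is_comonad ((H ◁ (τ ▷ H)) · (δ ★ δ)) (ε ★ ε).
Proof.
intros Hd Ht. split.
- componentwise. slide_all H.
  (* a comultiplication of each side passes through the inner crossing *)
  use (dent_comull Ht) under (H ∘ H). slide_all H.
  use (dent_comulr Ht) under H. slide_all H.
  use (comonad_coassoc Hd). slide_all H.
  use (comonad_coassoc Hd) under (H ∘ H ∘ H). slide_all H.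
  reflexivity.
- componentwise. use (dent_counitl Ht) under H. slide_all H.
  use (comonad_counitl Hd) under H. use (comonad_counitl Hd). reflexivity.
- componentwise. slide_all H.
  use (dent_counitr Ht) under H. slide_all H.
  use (comonad_counitr Hd) under H. use (comonad_counitr Hd). reflexivity.
Qed.

Section Twist.
Variables (A : category) (H : functor A A).
Variables (m : H ∘ H ⟹ H) (e : functor_id A ⟹ H).
Variables (δ : H ⟹ H ∘ H) (ε : H ⟹ functor_id A) (τ : H ∘ H ⟹ H ∘ H).
Hypothesis Ht : double_entwining m e δ ε τ.
Hypothesis yb : (τ ▷ H) · (H ◁ τ) · (τ ▷ H) ≡ (H ◁ τ) · (τ ▷ H) · (H ◁ τ).

(** Since [τ] slides through itself by Yang-Baxter, it slides through [m · τ] and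
    [τ · δ] as well. *)
Lemma opposite_double_entwining : double_entwining (m · τ) e (τ · δ) ε τ.
Proof.
split; try apply Ht; componentwise.
- use (dent_comull Ht). use yb. reflexivity.
- use (dent_mull Ht). use <- yb. reflexivity.
- use (dent_comulr Ht). use <- yb. reflexivity.
- use (dent_mulr Ht). use yb. reflexivity.
Qed.

Lemma opposite_is_monad : is_monad m e -> is_monad (m · τ) e.
Proof.
intros Hm. split; componentwise.
- use (dent_mull Ht). use (dent_mulr Ht). use (monad_assoc Hm). use yb.
  reflexivity.
- use (dent_unitl Ht). use (monad_unitr Hm). reflexivity.
- use (dent_unitr Ht). use (monad_unitl Hm). reflexivity.
Qed.

(** Sliding the outer crossings of [τ · δ · m · τ] inwards through [m ★ m] and
    [δ ★ δ] turns each of them into the crossing [c] of two pairs of strands. With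
    [s1], [s2], [s3] the crossings of neighbours among four strands, what is left
    is that [c s2 c] and [s1 s3 s2 s1 s3] are both the transposition of the outer
    two strands. *)
Lemma opposite_comul_mul : τ · τ ≡ nat_id (H ∘ H) ->
  δ · m ≡ (m ★ m) · (H ◁ (τ ▷ H)) · (δ ★ δ) ->
  (τ · δ) · (m · τ) ≡
    ((m · τ) ★ (m · τ)) · (H ◁ (τ ▷ H)) · ((τ · δ) ★ (τ · δ)).
Proof.
intros inv comul_mul. componentwise. use comul_mul.
use (dent_mull Ht). slide_all H.
use (dent_mulr Ht) under H. use (dent_mulr Ht).
use (dent_comull Ht). use (dent_comulr Ht) under H. use (dent_comulr Ht).
slide_all H.
(* The left-hand word is s2 s1 s3 s2 s2 s2 s3 s1 s2, up to commuting s1 and s3. *)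
use inv under H. slide <- τ. use <- yb under H.
use <- yb. use <- yb.
(* Now s1 s2 s1 s3 s1 s2 s1. *)
slide τ. use inv. use yb under H. slide_all H. reflexivity.
Qed.
End Twist.

Lemma opposite_tau_bimonad (A : category) (H : functor A A)
    (m : H ∘ H ⟹ H) (e : functor_id A ⟹ H)
    (δ : H ⟹ H ∘ H) (ε : H ⟹ functor_id A) (τ : H ∘ H ⟹ H ∘ H) :
  yang_baxter τ -> τ · τ ≡ nat_id (H ∘ H) ->
  tau_bimonad τ m e δ ε -> tau_bimonad τ (m · τ) e (τ · δ) ε.
Proof.
intros yb inv [Hm Hd Ht comul_mul counit_mul comul_unit counit_unit]. split.
- apply (opposite_is_monad Ht yb Hm).
- (* the same lemma in the opposite category *)
  destruct (opposite_is_monad (op_double_entwining Ht) (op_yang_baxter yb)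
    (op_comonad Hd)). split; assumption.
- apply (opposite_double_entwining Ht yb).
- apply (opposite_comul_mul Ht yb inv comul_mul).
- componentwise. use counit_mul. use (dent_counitr Ht). slide ε. reflexivity.
- componentwise. use comul_unit. use (dent_unitl Ht). slide e. reflexivity.
- exact counit_unit.
Qed.

(** * Antipodes *)

Section Antipode.
Variables (A : category) (H : functor A A).
Variables (m : H ∘ H ⟹ H) (e : functor_id A ⟹ H).
Variables (δ : H ⟹ H ∘ H) (ε : H ⟹ functor_id A) (τ : H ∘ H ⟹ H ∘ H).
Variable S : H ⟹ H.
Hypothesis HH : tau_bimonad τ m e δ ε.
Hypothesis HS : antipode m e δ ε S.

(** Both sides equal [m · (S ▷ H) · δ · e], because [δ · e] consists of two
    units. *)
Lemma antipode_unit : S · e ≡ e.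
Proof.
destruct HH as [Hm Hd Ht comul_mul counit_mul comul_unit counit_unit].
apply (nat_trans_eq (b := m · (S ▷ H) · δ · e)).
- apply nat_sym. componentwise. use comul_unit. slide e. slide S.
  use (monad_unitr Hm). reflexivity.
- componentwise. use (antipode_left HS). use counit_unit. reflexivity.
Qed.

(** [S · m] is a left convolution inverse of [m] since [m] is comultiplicative. That
    [m · τ · (S ★ S)] is a right inverse is, elementwise, the computation
    [a1 b1 S(b2) S(a2) = a1 S(a2) ε(b) = ε(a) ε(b)]. *)
Lemma antipode_mul :
  τ · (H ◁ S) ≡ (S ▷ H) · τ -> τ · (S ▷ H) ≡ (H ◁ S) · τ ->
  S · m ≡ m · τ · (S ★ S).
Proof.
intros τHS τSH.
destruct HH as [Hm Hd Ht comul_mul counit_mul comul_unit counit_unit].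
apply (convolution_inverse_unique (g := m) (composite_comonad Hd Ht) Hm).
- componentwise. use <- comul_mul. use (antipode_left HS). use counit_mul.
  reflexivity.
- componentwise. use τSH under (H ∘ H). use τHS under (H ∘ H).
  (* the two crossings merge into one with the second argument undivided *)
  slide δ. use <- (dent_comull Ht) under H.
  (* bracket as a1 ((b1 S(b2)) S(a2)) and cancel the inner factor *)
  use (monad_assoc Hm). use <- (monad_assoc Hm) under H. slide_all H.
  use (antipode_right HS) under H. use (dent_counitl Ht) under H.
  slide <- e under H. use (monad_unitl Hm) under H. slide_all H.
  use (antipode_right HS). slide_all H. reflexivity.
Qed.
End Antipode.

Lemma antipode_counit (A : category) (H : functor A A)
    (m : H ∘ H ⟹ H) (e : functor_id A ⟹ H)
    (δ : H ⟹ H ∘ H) (ε : H ⟹ functor_id A) (τ : H ∘ H ⟹ H ∘ H) (S : H ⟹ H) :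
  tau_bimonad τ m e δ ε -> antipode m e δ ε S -> ε · S ≡ ε.
Proof.
intros HH HS. exact (antipode_unit (op_tau_bimonad HH) (op_antipode HS)).
Qed.

Lemma antipode_comul (A : category) (H : functor A A)
    (m : H ∘ H ⟹ H) (e : functor_id A ⟹ H)
    (δ : H ⟹ H ∘ H) (ε : H ⟹ functor_id A) (τ : H ∘ H ⟹ H ∘ H) (S : H ⟹ H) :
  tau_bimonad τ m e δ ε -> antipode m e δ ε S ->
  τ · (H ◁ S) ≡ (S ▷ H) · τ -> τ · (S ▷ H) ≡ (H ◁ S) · τ ->
  δ · S ≡ (S ★ S) · τ · δ.
Proof.
intros HH HS τHS τSH.
pose proof (antipode_mul (op_tau_bimonad HH) (op_antipode HS)
  (nat_sym τSH) (nat_sym τHS)) as E.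
intros X. etransitivity; [exact (E X)|].
pose proof (hcomp_interchange S S X) as SS. simpl in SS |- *.
rewrite SS, <- !comp_assoc. reflexivity.
Qed.

Theorem mainTheorem7 (A : category) (H : functor A A)
    (m : H ∘ H ⟹ H) (e : functor_id A ⟹ H)
    (δ : H ⟹ H ∘ H) (ε : H ⟹ functor_id A)
    (τ : H ∘ H ⟹ H ∘ H)
    (Hτ : local_prebraiding m e δ ε τ)
    (Hτ2 : τ · τ ≡ nat_id (H ∘ H))
    (HH : tau_bimonad τ m e δ ε) :
  tau_bimonad τ (m · τ) e (τ · δ) ε
  /\
  (forall S : H ⟹ H,
     antipode m e δ ε S ->
     τ · (H ◁ S) ≡ (S ▷ H) · τ ->
     τ · (S ▷ H) ≡ (H ◁ S) · τ ->
     tau_bimonad_morphism m e δ ε (m · τ) e (τ · δ) ε S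
     /\ antipode (m · τ) e (τ · δ) ε S).
Proof.
destruct Hτ as [Ht yb]. split.
- exact (opposite_tau_bimonad yb Hτ2 HH).
- intros S HS τHS τSH. split; [split; split|split].
  + componentwise. use (antipode_mul HH HS τHS τSH). reflexivity.
  + exact (antipode_unit HH HS).
  + componentwise. use (antipode_comul HH HS τHS τSH).
    use τSH. use τHS. use Hτ2. slide S. reflexivity.
  + exact (antipode_counit HH HS).
  + (* the crossings of m · τ and τ · δ cancel, exchanging the two antipode axioms *)
    componentwise. use <- τHS. use Hτ2. use (antipode_right HS). reflexivity.
  + componentwise. use <- τSH. use Hτ2. use (antipode_left HS). reflexivity.
Qed.
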